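(* Let $D$ be a skew field of finite dimension over $\mathbb{Q}$, $n\geq 2$ an integer, and $G$ a finite subgroup of the group of ring automorphisms of $\mathrm{M}_n(D)$. Then for every $k\in\{1,\dots,n-1\}$ there are infinitely many right ideals $I$ of $\mathrm{M}_n(D)$ whose associated right vector subspace $V\subset D^n$ has dimension $k$ and which are stable by no element of $G\setminus\{1\}$, i.e. $g(I)\neq I$ for all $g\in G\setminus\{1\}$.
   Context: For a right ideal $I$ of $\mathrm{M}_n(D)$, the associated right $D$-vector subspace of $D^n$ is the sum of the images of the elements of $I$ acting on column vectors; this is a bijection between right ideals of $\mathrm{M}_n(D)$ and right $D$-vector subspaces of $D^n$. *)

(* Defs.v *)
From HB Require Import structures.
From mathcomp Require Import all_boot all_order all_algebra all_field.
From mathcomp Require Import boolp classical_sets functions cardinality.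

Set Implicit Arguments.
Unset Strict Implicit.
Unset Printing Implicit Defensive.

Import GRing.Theory.
Local Open Scope classical_set_scope.
Local Open Scope ring_scope.

Definition skew_field (D : unitRingType) : Prop :=
  forall x : D, x != 0 -> x \is a GRing.unit.

Definition ring_automorphism (R : pzRingType) (f : R -> R) : Prop :=
  [/\ GRing.zmod_morphism f, GRing.monoid_morphism f & bijective f].

(* The group law on automorphisms is composition. *)
Definition ring_automorphism_subgroup (R : pzRingType) (G : set (R -> R)) :
    Prop :=
  [/\ forall g, G g -> ring_automorphism g,
      G idfun,
      forall g h, G g -> G h -> G (g \o h)
    & forall g, G g -> exists h, [/\ G h, cancel g h & cancel h g]].

Definition right_ideal (R : pzRingType) (I : set R) : Prop :=
  [/\ I 0,
      forall x y, I x -> I y -> I (x - y)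
    & forall x a, I x -> I (x * a)].

(* The sum of the images of the A in I acting on columns: the set of all
   finite sums of vectors A *m x with A in I. *)
Definition associated_subspace (D : pzRingType) (n : nat) (I : set 'M[D]_n) :
    set 'cV[D]_n :=
  [set v | exists (m : nat) (A : 'I_m -> 'M[D]_n) (x : 'I_m -> 'cV[D]_n),
     (forall i, I (A i)) /\ v = \sum_(i < m) A i *m x i].

(* As D need not be commutative, scalars act on columns from the right, and
   right multiplication of the column v by a is v *m a%:M (with a%:M a 1 x 1
   matrix); the library's a *: v is the left action. *)
Definition right_comb (D : pzRingType) (n k : nat) (b : 'I_k -> 'cV[D]_n)
    (c : 'I_k -> D) : 'cV[D]_n :=
  \sum_(j < k) b j *m (c j)%:M.

(* V is a right subspace of D^n having a basis of k vectors. *)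
Definition has_right_dim (D : pzRingType) (n : nat) (V : set 'cV[D]_n)
    (k : nat) : Prop :=
  exists b : 'I_k -> 'cV[D]_n,
    (forall c : 'I_k -> D, right_comb b c = 0 -> forall j, c j = 0) /\
    V = [set v | exists c : 'I_k -> D, v = right_comb b c].

(* Main.v *)
Require Import Defs.
From HB Require Import structures.
From mathcomp Require Import all_boot all_order all_algebra all_field.
From mathcomp Require Import boolp classical_sets functions cardinality.
From mathcomp Require Import zify.

(* Put R = M_n(D) and let e be the diagonal idempotent of rank k. For x in R
   the element u(x) = e + (1 - e) x e is idempotent, and u(x) R is a right
   ideal whose associated subspace has dimension k. If g stabilizes u(x) R,
   then (1 - u) g(u) = 0 and (1 - g(u)) u = 0 for u = u(x), which are quadratic
   equations in x. If these hold for every x, then g = 1: comparing degrees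
   gives g(e) = e + z with y z y = 0 for all y in (1 - e) R e, so z = 0 as R is
   prime; then g fixes (1 - e) R e pointwise, and hence, again by primeness, R.
   So each g <> 1 excludes a proper quadratic locus of parameters x, and in
   characteristic 0 finitely many of these miss all but finitely many integral
   points of some line, along which the ideals u(x) R are distinct. *)

Local Open Scope classical_set_scope.
Local Open Scope ring_scope.
Import GRing.Theory.

(** * Quadratic maps on half-lines and avoidance of thin sets *)

Definition torsion_free (V : zmodType) : Prop :=
  forall (a : V) m, a *+ m.+1 = 0 -> a = 0.

Definition prime_ring (R : pzRingType) : Prop :=
  forall a b : R, (forall x, a * x * b = 0) -> a = 0 \/ b = 0.

Lemma torsion_free_mulrn {V : zmodType} (tf : torsion_free V) {a : V} {m} :
  (0 < m)%N -> a *+ m = 0 -> a = 0.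
Proof. by case: m => // m _; apply: tf. Qed.

(** Divided differences: subtracting two values and cancelling the gap between the points leaves a
    relation linear in the points; a second difference isolates [C]. *)
Lemma quadratic_three_roots {V : zmodType} (tf : torsion_free V) {A B C : V}
    {t1 t2 t3 : nat} :
  (t1 < t2)%N -> (t2 < t3)%N ->
  (forall t, t \in [:: t1; t2; t3] -> A + B *+ t + C *+ (t * t) = 0) ->
  [/\ A = 0, B = 0 & C = 0].
Proof.
move=> lt12 lt23 root.
have step r s : (r < s)%N -> A + B *+ r + C *+ (r * r) = 0 ->
    A + B *+ s + C *+ (s * s) = 0 -> B + C *+ (r + s) = 0.
  move=> ltrs r0; rewrite -(subnKC (ltnW ltrs)).
  move: (subn_gt0 r s); rewrite ltrs; move: (s - r)%N => d d0.
  have -> : ((r + d) * (r + d) = r * r + (r + (r + d)) * d)%N by lia.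
  rewrite (mulrnDr B) (mulrnDr C (r * r)) (mulrnA C _ d) (addrA A) addrACA r0 add0r => s0.
  by apply: (torsion_free_mulrn tf d0); rewrite mulrnDl.
have r1 := root t1 ltac:(by rewrite !inE eqxx).
have r2 := root t2 ltac:(by rewrite !inE eqxx ?orbT).
have r3 := root t3 ltac:(by rewrite !inE eqxx ?orbT).
have s12 := step _ _ lt12 r1 r2; have s23 := step _ _ lt23 r2 r3.
have C0 : C = 0.
  apply: (torsion_free_mulrn tf (m := t3 - t1)); first by lia.
  have t13 : (t1 <= t3)%N by lia.
  have /addrI := etrans s12 (esym s23).
  by rewrite addnC !mulrnDr mulrnBr // => /addrI ->; rewrite subrr.
move: s12 r1; rewrite C0 !mul0rn addr0 => ->.
by rewrite mul0rn !addr0.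
Qed.

(* Stands in for "zero set of quadratic equations": only the intersections
   with the half-lines [x + w *+ t], [t : nat], are ever used. *)
Definition thin {V : zmodType} (Z : set V) : Prop :=
  forall x w, (exists t, ~ Z (x + w *+ t)) ->
    exists N, forall t, (N <= t)%N -> ~ Z (x + w *+ t).

(** Three zeros kill all coefficients, so zeros arbitrarily far along a half-line force vanishing on
    all of it. *)
Lemma thin_quadratic {V W : zmodType} (tf : torsion_free W) (F : V -> W) :
  (forall x w, exists B C,
     forall t, F (x + w *+ t) = F x + B *+ t + C *+ (t * t)) ->
  thin [set x | F x = 0].
Proof.
move=> quad x w [t0 nz]; have [B [C FE]] := quad x w.
apply: contrapT => noN.
have next N : exists2 t, (N <= t)%N & F (x + w *+ t) = 0.
  apply: contrapT => no; apply: noN; exists N => t leNt Ft.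
  by apply: no; exists t.
have [t1 _ r1] := next 0%N; have [t2 lt12 r2] := next t1.+1.
have [t3 lt23 r3] := next t2.+1.
have [|A0 B0 C0] :=
    quadratic_three_roots (A := F x) (B := B) (C := C) tf lt12 lt23.
  by move=> t; rewrite !inE => /or3P[] /eqP ->; rewrite -FE.
by apply: nz; rewrite /= FE A0 B0 C0 !mul0rn !addr0.
Qed.

Lemma thinI {V : zmodType} (Z1 Z2 : set V) :
  thin Z1 -> thin Z2 -> thin (Z1 `&` Z2).
Proof.
move=> thin1 thin2 x w [t nZ].
have [Z1t|nZ1] := pselect (Z1 (x + w *+ t)).
  have [|N nZ2] := thin2 x w; first by exists t => Z2t; apply: nZ.
  by exists N => s /nZ2 + [].
by have [|N nZ1'] := thin1 x w; [exists t | exists N => s /nZ1' + []].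
Qed.

(** One [x] serves all directions [w], since the induction moves the base point in a direction not
    known beforehand. *)
Lemma thin_avoid {V : zmodType} {T : eqType} (Z : T -> set V) (s : seq T) :
  (forall i, i \in s -> thin (Z i)) ->
  (forall i, i \in s -> exists x, ~ Z i x) ->
  exists x, forall w, exists N, forall t i,
    (N <= t)%N -> i \in s -> ~ Z i (x + w *+ t).
Proof.
elim: s => [|i s IH] thinZ propZ; first by exists 0 => w; exists 0%N.
have [||x xP] := IH; first by move=> j js; apply: thinZ; rewrite inE js orbT.
  by move=> j js; apply: propZ; rewrite inE js orbT.
have [y nZy] := propZ i (mem_head _ _).
(* The half-line from [x] towards [y] meets [y] at [t = 1], so beyond both bounds it avoids [Z i]
   and the sets of [s]; the new base point is taken there. *)
have [|N1 N1P] := thinZ i (mem_head _ _) x (y - x).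
  by exists 1%N; rewrite mulr1n addrC subrK.
have [N2 N2P] := xP (y - x).
exists (x + (y - x) *+ (maxn N1 N2)) => w.
have tail j : j \in i :: s -> exists N, forall t, (N <= t)%N ->
    ~ Z j (x + (y - x) *+ maxn N1 N2 + w *+ t).
  move=> jis; apply: (thinZ j jis); exists 0%N; rewrite mulr0n addr0.
  move: jis; rewrite inE => /predU1P[->|js]; first by apply: N1P; lia.
  by apply: N2P => //; lia.
elim: (i :: s) tail => [|j r IHr] tail; first by exists 0%N.
have [M MP] := IHr (fun k kr => tail k ltac:(by rewrite inE kr orbT)).
have [M' M'P] := tail j (mem_head _ _).
exists (maxn M M') => t k leMt; rewrite inE => /predU1P[->|kr].
  by apply: M'P; lia.
by apply: MP => //; lia.
Qed.

(** * Prime rings and tilted idempotents *)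

(** Linearizing makes [z x z w z] antisymmetric in [x] and [w]; hence
    [z x z w z x z = - z w (z x z x z) = 0], and primeness applies twice. *)
Lemma prime_ring_cube0 {R : pzRingType} (prR : prime_ring R) (z : R) :
  (forall x, z * x * z * x * z = 0) -> z = 0.
Proof.
move=> nil.
have anti x w : z * x * z * w * z = - (z * w * z * x * z).
  apply/eqP; rewrite -addr_eq0; apply/eqP; have := nil (x + w).
  by rewrite !(mulrDr, mulrDl) !nil add0r addr0 addrC.
suff zxz x : z * x * z = 0 by case: (prR z z zxz).
suff zxzw w : z * x * z * w * (z * x * z) = 0 by case: (prR _ _ zxzw).
have -> : z * x * z * w * (z * x * z) = - (z * w * (z * x * z * x * z)).
  by rewrite -!mulNr !mulrA anti !mulNr.
by rewrite nil mulr0 oppr0.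
Qed.

(** The component of [x] in the Peirce corner [(1 - e) R e]. *)
Definition tilt {R : pzRingType} (e x : R) : R := (1 - e) * x * e.

(** For an idempotent matrix [e], the column space of [tilted e x] is the graph of [tilt e x] over
    that of [e]: a point of an affine chart of the Grassmannian. *)
Definition tilted {R : pzRingType} (e x : R) : R := e + tilt e x.

Section Idempotent.
Context {R : pzRingType} {e : R} (ee : e * e = e).

Lemma mul_idem_compl : e * (1 - e) = 0.
Proof. by rewrite mulrBr mulr1 ee subrr. Qed.

Lemma tilt_idem x : tilt e x * e = tilt e x.
Proof. by rewrite /tilt -(mulrA _ e e) ee. Qed.

Lemma idem_tilt x : e * tilt e x = 0.
Proof. by rewrite /tilt !mulrA mul_idem_compl !mul0r. Qed.

Lemma tilted_idem x : tilted e x * e = tilted e x.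
Proof. by rewrite mulrDl ee tilt_idem. Qed.

Lemma idem_tilted x : e * tilted e x = e.
Proof. by rewrite mulrDr ee idem_tilt addr0. Qed.

(** Idempotence is the case [x = y]; in general, all these idempotents generate the same left
    ideal. *)
Lemma tilted_tilted x y : tilted e x * tilted e y = tilted e x.
Proof. by rewrite -{1}tilted_idem -mulrA idem_tilted tilted_idem. Qed.

End Idempotent.

Lemma tiltDn {R : pzRingType} (e x w : R) t :
  tilt e (x + w *+ t) = tilt e x + tilt e w *+ t.
Proof. by rewrite /tilt mulrDr mulrDl mulrnAr mulrnAl. Qed.

Lemma tiltedDn {R : pzRingType} (e x w : R) t :
  tilted e (x + w *+ t) = tilted e x + tilt e w *+ t.
Proof. by rewrite /tilted tiltDn addrA. Qed.

Lemma mul_affine {R : pzRingType} (a b c d : R) t :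
  (a + b *+ t) * (c + d *+ t)
    = a * c + (a * d + b * c) *+ t + (b * d) *+ (t * t).
Proof.
by rewrite mulrDl !mulrDr !mulrnAr !mulrnAl -mulrnA mulrnDl !addrA.
Qed.

(** * Equations for the stability of tilted ideals *)

Section FixedIdeals.
Context {R : pzRingType} (e : R) (g : {rmorphism R -> R}).

Let u := tilted e.
Let y := tilt e.

Lemma tilted_obstructionl x w t :
  (1 - u (x + w *+ t)) * g (u (x + w *+ t))
  = (1 - u x) * g (u x)
    + ((1 - u x) * g (y w) + (- y w) * g (u x)) *+ t
    + (- y w * g (y w)) *+ (t * t).
Proof.
by rewrite -mul_affine /u tiltedDn rmorphD rmorphMn opprD mulNrn addrA.
Qed.

Lemma tilted_obstructionr x w t :
  (1 - g (u (x + w *+ t))) * u (x + w *+ t)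
  = (1 - g (u x)) * u x
    + ((1 - g (u x)) * y w + (- g (y w)) * u x) *+ t
    + (- g (y w) * y w) *+ (t * t).
Proof.
by rewrite -mul_affine /u tiltedDn rmorphD rmorphMn opprD mulNrn addrA.
Qed.

Lemma thin_fixed_tilted (tf : torsion_free R) :
  thin ([set x | (1 - u x) * g (u x) = 0] `&`
        [set x | (1 - g (u x)) * u x = 0]).
Proof.
apply: thinI; apply: (thin_quadratic tf) => x w; do 2!eexists.
- exact: (tilted_obstructionl x w).
- exact: (tilted_obstructionr x w).
Qed.

Lemma rmorph_fix_tilted (tf : torsion_free R) (prR : prime_ring R) :
  e * e = e -> e <> 0 -> e <> 1 ->
  (forall x, (1 - u x) * g (u x) = 0 /\ (1 - g (u x)) * u x = 0) ->
  forall r, g r = r.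
Proof.
move=> ee e0 e1 fixu.
have f0 : 1 - e <> 0 by move/eqP; rewrite subr_eq0 => /eqP /esym.
have u0 : u 0 = e by rewrite /u /tilted /tilt mulr0 mul0r addr0.
have cancelf a : (forall x, (1 - e) * x * a = 0) -> a = 0 by case/prR.
have cancele a : (forall x, a * x * e = 0) -> a = 0 by case/prR.
(* On the half-line from [0] in direction [w], the constant, linear and quadratic coefficients
   vanish separately. *)
have eqsl w : [/\ (1 - e) * g e = 0, (1 - e) * g (y w) = y w * g e
    & y w * g (y w) = 0].
  have [||t _|] := quadratic_three_roots tf (t1 := 0) (t2 := 1) (t3 := 2)
    (A := (1 - u 0) * g (u 0))
    (B := (1 - u 0) * g (y w) + (- y w) * g (u 0)) (C := - y w * g (y w)) => //.
    by rewrite -tilted_obstructionl; case: (fixu (0 + w *+ t)).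
  rewrite u0 => -> /eqP + /eqP.
  by rewrite !mulNr subr_eq0 oppr_eq0 => /eqP -> /eqP ->.
have eqsr w : [/\ (1 - g e) * e = 0, (1 - g e) * y w = g (y w) * e
    & g (y w) * y w = 0].
  have [||t _|] := quadratic_three_roots tf (t1 := 0) (t2 := 1) (t3 := 2)
    (A := (1 - g (u 0)) * u 0)
    (B := (1 - g (u 0)) * y w + (- g (y w)) * u 0) (C := - g (y w) * y w) => //.
    by rewrite -tilted_obstructionr; case: (fixu (0 + w *+ t)).
  rewrite u0 => -> /eqP + /eqP.
  by rewrite !mulNr subr_eq0 oppr_eq0 => /eqP -> /eqP ->.
have ge : g e = e.
  apply/eqP; rewrite -subr_eq0; apply/eqP; set z := g e - e.
  (* The constant terms place [z] in the opposite corner [e R (1 - e)]. *)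
  have zf : z * (1 - e) = z.
    rewrite mulrBr mulr1 -[RHS]subr0; congr (_ - _).
    have [/eqP + _ _] := eqsr 0; rewrite mulrBl mul1r subr_eq0 => /eqP h.
    by rewrite mulrBl -h ee subrr.
  have ez : e * z = z.
    have [/eqP + _ _] := eqsl 0; rewrite mulrBl mul1r subr_eq0 => /eqP h.
    by rewrite mulrBr -h ee.
  have yzy w : y w * z * y w = 0.
    have [_ _ h3] := eqsl w; have [_ h2 _] := eqsr w.
    have : y w * ((1 - g e) * y w) = 0 by rewrite h2 mulrA h3 mul0r.
    have -> : 1 - g e = (1 - e) - z by rewrite opprB addrA subrK.
    rewrite mulrBl mulrBr !(mulrA _ _ (y w)) -{1}[y w](tilt_idem ee w) -(mulrA _ e).
    rewrite (mul_idem_compl ee) mulr0 mul0r sub0r => /eqP.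
    by rewrite oppr_eq0 => /eqP.
  (* As [z (1 - e) = z] and [e z = z], the product [z (y x) z (y x) z] is [z x z x z]. *)
  apply: (prime_ring_cube0 prR) => x.
  have := congr1 (fun a => z * a * z) (yzy x).
  rewrite mulr0 mul0r => <-.
  by rewrite /y /tilt !mulrA zf -!(mulrA _ e z) ez -(mulrA _ z (1 - e)) zf.
have gy w : g (y w) = y w.
  have [_ h2 _] := eqsr w.
  rewrite -{1}[y w](tilt_idem ee w) rmorphM ge -h2 ge mulrBl mul1r.
  by rewrite (idem_tilt ee) subr0.
(* The [(1 - e)]-part of [r e] is [y r], which [g] fixes; the [e]-part is tested by left
   multiplication by each [y x], which lands again in the fixed corner. *)
have gre r : g r * e = r * e.
  have fre : (1 - e) * (g r * e - r * e) = 0.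
    by rewrite mulrBr !mulrA -[X in _ - X]gy !rmorphM rmorphB rmorph1 ge subrr.
  have ere : e * (g r * e - r * e) = 0.
    apply: cancelf => x.
    have yre : y x * r * e = y (x * e * r) by rewrite /y /tilt !mulrA.
    have ygre : y x * g r * e = y x * r * e.
      by rewrite [in RHS]yre -[RHS]gy -yre (rmorphM g _ e) (rmorphM g _ r) gy ge.
    rewrite !mulrA -/(tilt e x) mulrBr !mulrA; apply/eqP; rewrite subr_eq0.
    exact/eqP.
  apply/eqP; rewrite -subr_eq0 -[X in X == 0]mul1r.
  by rewrite -(subrK e 1) mulrDl fre ere addr0.
move=> r; apply/eqP; rewrite -subr_eq0 -[X in X == 0]mulr1 -(subrK e 1) mulrDr.
have -> : (g r - r) * e = 0 by rewrite mulrBl gre subrr.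
rewrite addr0; apply/eqP; apply: cancele => x.
have := gre (r * y x).
rewrite rmorphM gy -(mulrA (g r)) -(mulrA r) [y x * e](tilt_idem ee) => gry.
have -> : (g r - r) * (1 - e) * x * e = g r * y x - r * y x.
  by rewrite -mulrBl /y /tilt !mulrA.
by rewrite gry subrr.
Qed.
End FixedIdeals.

(** * Infinitely many unstable right ideals in a prime ring *)

(* For [u] idempotent this is the principal right ideal [u R]. *)
Definition left_fixed {R : pzRingType} (u : R) : set R := [set a | u * a = a].

Lemma right_ideal_left_fixed {R : pzRingType} (u : R) :
  right_ideal (left_fixed u).
Proof.
split=> [|x y /= ux uy|x a /= ux]; rewrite /left_fixed /=.
- by rewrite mulr0.
- by rewrite mulrBr ux uy.
- by rewrite mulrA ux.
Qed.

Lemma stable_left_fixed {R : pzRingType} (g : {rmorphism R -> R}) (u : R) :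
  u * u = u -> g @` left_fixed u = left_fixed u ->
  (1 - u) * g u = 0 /\ (1 - g u) * u = 0.
Proof.
move=> uu guE; split.
- have ugu : left_fixed u (g u) by rewrite -guE; exists u.
  by rewrite mulrBl mul1r ugu subrr.
- have : left_fixed u u by []; rewrite -{1}guE => -[a ua gau].
  by rewrite mulrBl mul1r -{3}gau -rmorphM ua gau subrr.
Qed.

(** [tilted e x'] lies in its own ideal, hence is fixed by [tilted e x] on the left; but that
    product is [tilted e x]. *)
Lemma left_fixed_tilted_inj {R : pzRingType} (e x x' : R) : e * e = e ->
  left_fixed (tilted e x) = left_fixed (tilted e x') -> tilt e x = tilt e x'.
Proof.
move=> ee eqI; have : left_fixed (tilted e x') (tilted e x').
  exact: tilted_tilted.
by rewrite -eqI /left_fixed /= tilted_tilted // => /addrI.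
Qed.

Lemma infinite_unstable_left_fixed {R : pzRingType} (e : R)
    (G : set (R -> R)) :
  torsion_free R -> prime_ring R -> e * e = e -> e <> 0 -> e <> 1 ->
  finite_set G -> (forall g, G g -> ring_automorphism g) ->
  infinite_set [set I | exists2 x, I = left_fixed (tilted e x)
                        & forall g, G g -> g <> idfun -> g @` I <> I].
Proof.
move=> tf prR ee e0 e1 finG autG.
have /finite_seqP[s sE] : finite_set (G `&` [set g | g <> idfun]).
  by apply: sub_finite_set finG => g [].
pose Z (g : R -> R) : set R :=
  [set x | (1 - tilted e x) * g (tilted e x) = 0] `&`
  [set x | (1 - g (tilted e x)) * tilted e x = 0].
have morph g : G g -> exists h : {rmorphism R -> R}, g = h :> (R -> R).
  case/autG => gB gM _.
  pose B := GRing.isZmodMorphism.Build R R g gB.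
  pose M := GRing.isMonoidMorphism.Build R R g gM.
  pose h : {rmorphism R -> R} := HB.pack g B M.
  by exists h.
have sG g : g \in s -> G g /\ g <> idfun.
  by move=> gs; have : [set` s] g by []; rewrite -sE.
have [||x xP] := thin_avoid Z s.
- by move=> g /sG[/morph[h ->] _]; apply: thin_fixed_tilted.
- move=> g /sG[/morph[h ->] h1]; apply: contrapT => noX; apply: h1.
  apply/funext => r; apply: (rmorph_fix_tilted e h tf prR ee e0 e1) => x.
  by apply: contrapT => nZ; apply: noX; exists x.
(* A direction along which the ideals really vary. *)
have [w w0] : exists w, tilt e w <> 0.
  apply: contrapT => no; have [a|/eqP|//] := prR (1 - e) e.
  - by apply: contrapT => a0; apply: no; exists a.
  - by rewrite subr_eq0 => /eqP/esym.
have [N NP] := xP w.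
pose I t := left_fixed (tilted e (x + w *+ (N + t))).
have injI : injective I.
  move=> t t' /(left_fixed_tilted_inj _ _ _ ee).
  rewrite !tiltDn !mulrnDr => /addrI/addrI eqt.
  wlog ltt : t t' eqt / (t <= t')%N.
    by move=> H; case/orP: (leq_total t t') => [/H->|/H->].
  apply: contrapT => /eqP net; apply: w0.
  apply: (torsion_free_mulrn tf (m := t' - t)); first by lia.
  by rewrite mulrnBr // eqt subrr.
move=> /(finite_preimage (f := I)) finI; apply: infinite_nat.
apply: sub_finite_set (finI _); last by move=> ? ? _ _; apply: injI.
move=> t _; exists (x + w *+ (N + t)) => // g Gg g1 gI.
have gs : g \in s by have : [set` s] g by rewrite -sE.
have [h gh] := morph g Gg.
apply: (NP (N + t)%N g (leq_addr _ _) gs); rewrite /Z gh.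
by apply: stable_left_fixed; [apply: tilted_tilted | rewrite -gh].
Qed.

(** * Matrix rings over a skew field *)

Lemma torsion_free_lmod_rat (V : lmodType rat) : torsion_free V.
Proof.
move=> a m; rewrite -(scaler_nat m.+1 a) => /eqP.
by rewrite scaler_eq0 Num.Theory.pnatr_eq0 => /eqP.
Qed.

Lemma torsion_free_matrix {V : zmodType} m n :
  torsion_free V -> torsion_free 'M[V]_(m, n).
Proof.
move=> tf A p /matrixP A0; apply/matrixP => i j; rewrite mxE.
by apply: (tf _ p); have := A0 i j; rewrite mulmxnE mxE.
Qed.

(** A matrix unit is a column times a row, so the product is column [j] of [A] times row [k] of
    [B]. *)
Lemma mulmx_delta_mulmx {R : pzRingType} m n p q (A : 'M[R]_(m, n))
    (B : 'M[R]_(p, q)) i j k l :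
  (A *m delta_mx j k *m B) i l = A i j * B k l.
Proof.
rewrite -(mul_delta_mx (0 : 'I_1)) mulmxA -colE -mulmxA -rowE.
by rewrite mxE big_ord1 !mxE.
Qed.

Lemma prime_matrix_ring (D : unitRingType) n :
  skew_field D -> prime_ring 'M[D]_n.
Proof.
move=> hD A B AB0.
have [->|/matrix0Pn[i [j Aij]]] := eqVneq A 0; first by left.
right; apply/matrixP => k l; rewrite mxE.
have /matrixP/(_ i l) := AB0 (delta_mx j k).
rewrite mulmx_delta_mulmx mxE => AB; apply: (mulrI (hD _ Aij)).
by rewrite AB mulr0.
Qed.

(** * Dimension of the associated subspace *)

Lemma right_comb_delta {D : pzRingType} {n k : nat} (le_kn : (k <= n)%N)
    (c : 'I_k -> D) (i : 'I_n) :
  right_comb (fun j => delta_mx (widen_ord le_kn j) 0) c i 0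
  = if insub (i : nat) is Some j then c j else 0.
Proof.
rewrite /right_comb summxE.
have E (j : 'I_k) : ((delta_mx (widen_ord le_kn j) 0 : 'cV[D]_n)
    *m (c j)%:M) i 0 = if i == widen_ord le_kn j then c j else 0.
  rewrite mxE big_ord1 !mxE eqxx andbT mulr1n.
  by case: (_ == _); rewrite ?mul1r ?mul0r.
under eq_bigr do rewrite E.
case: insubP => [j _ ji|ik].
  rewrite (bigD1 j) //= big1 ?addr0 => [|j' nj].
    by rewrite ifT //; apply/eqP/val_inj.
  rewrite ifF //; apply: contraNF nj => /eqP ij.
  by apply/eqP/val_inj; rewrite ji ij.
rewrite big1 // => j _; rewrite ifF //.
by apply: contraNF ik => /eqP ->; exact: (ltn_ord j).
Qed.

Lemma pid_mx_mul_col {D : pzRingType} {n k : nat} (le_kn : (k <= n)%N)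
    (v : 'cV[D]_n) :
  (pid_mx k : 'M_n) *m v
  = right_comb (fun j => delta_mx (widen_ord le_kn j) 0)
      (fun j => v (widen_ord le_kn j) 0).
Proof.
apply/matrixP => i z; rewrite (ord1 z) right_comb_delta mxE (bigD1 i) //=.
rewrite big1 ?addr0 => [|j ji]; rewrite !mxE.
  rewrite eqxx /=; case: insubP => [j _ ij|/negbTE ->]; last by rewrite mul0r.
  by rewrite -ij ltn_ord mul1r; congr (v _ _); apply: val_inj.
by rewrite eq_sym -val_eqE in ji; rewrite (negbTE ji) mul0r.
Qed.

Lemma mulmx_right_comb {D : pzRingType} {m n k : nat} (u : 'M[D]_(m, n))
    (b : 'I_k -> 'cV[D]_n) (c : 'I_k -> D) :
  u *m right_comb b c = right_comb (fun j => u *m b j) c.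
Proof. by rewrite mulmx_sumr; apply: eq_bigr => j _; rewrite mulmxA. Qed.

Lemma associated_subspace_left_fixed {D : pzRingType} {n : nat}
    (u : 'M[D]_n) : u * u = u ->
  associated_subspace (left_fixed u) = [set v | u *m v = v].
Proof.
move=> uu; apply/seteqP; split=> v /=.
  case=> m [A [x [uA ->]]]; rewrite mulmx_sumr.
  by apply: eq_bigr => i _; rewrite mulmxA; congr (_ *m _); exact: uA.
move=> uv; exists 1%N, (fun _ => u), (fun _ => v); split=> //.
by rewrite big_ord1 uv.
Qed.

(** The basis is the image under [u] of the first [k] standard vectors: [e u = e] gives
    independence, [u e = u] gives spanning. *)
Lemma has_right_dim_tilted {D : pzRingType} {n k : nat} (x : 'M[D]_n) :
  (k <= n)%N ->
  has_right_dim (associated_subspace (left_fixed (tilted (pid_mx k) x))) k.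
Proof.
move=> le_kn; set e : 'M[D]_n := pid_mx k; set u := tilted e x.
have ee : e * e = e by apply: pid_mx_id.
pose d j : 'cV[D]_n := delta_mx (widen_ord le_kn j) 0.
have dE c j : right_comb d c (widen_ord le_kn j) 0 = c j.
  rewrite right_comb_delta; case: insubP => [j' _ /= jj|/=]; last by rewrite ltn_ord.
  by congr c; apply: val_inj.
have eu : e *m u = e by exact: idem_tilted.
have ue : u *m e = u by exact: tilted_idem.
have uu : u * u = u by exact: tilted_tilted.
have ed c : e *m right_comb d c = right_comb d c.
  rewrite pid_mx_mul_col; congr right_comb; apply/funext => j; exact: dE.
exists (fun j => u *m d j); split=> [c c0 j|].
  rewrite -dE -ed -eu -mulmxA mulmx_right_comb c0 mulmx0; exact: mxE.
rewrite associated_subspace_left_fixed //; apply/seteqP; split=> v /=.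
  move=> uv; exists (fun j => v (widen_ord le_kn j) 0).
  by rewrite -mulmx_right_comb -pid_mx_mul_col mulmxA ue.
by case=> c ->; rewrite -mulmx_right_comb mulmxA; congr (_ *m _).
Qed.

Theorem theorem4p4 (D : falgType rat) (hD : skew_field D)
    (n : nat) (hn : (2 <= n)%N)
    (G : set ('M[D]_n -> 'M[D]_n))
    (hG : ring_automorphism_subgroup G) (finG : finite_set G)
    (k : nat) (hk : (1 <= k <= n.-1)%N) :
  infinite_set
    [set I : set 'M[D]_n |
      [/\ right_ideal I,
          has_right_dim (associated_subspace I) k
        & forall g, G g -> g <> idfun -> g @` I <> I]].
Proof.
have [k0 kn] : (0 < k)%N /\ (k < n)%N by lia.
have [autG _ _ _] := hG.
(* The diagonal entries of [e] at [0] and [k] are [1] and [0], whence [e <> 0] and [e <> 1]. *)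
pose i0 := Ordinal (leq_trans k0 (ltnW kn)); pose ik := Ordinal kn.
set e : 'M[D]_n := pid_mx k.
have ee : e * e = e by apply: pid_mx_id; lia.
have e0 : e <> 0.
  move/matrixP/(_ i0 i0); rewrite !mxE eqxx k0 => /eqP.
  by rewrite oner_eq0.
have e1 : e <> 1.
  move/matrixP/(_ ik ik); rewrite !mxE eqxx ltnn => /esym/eqP.
  by rewrite eqxx oner_eq0.
have tf : torsion_free 'M[D]_n.
  by apply: torsion_free_matrix; apply: torsion_free_lmod_rat.
have prM := @prime_matrix_ring D n hD.
apply: contra_not (infinite_unstable_left_fixed e G tf prM ee e0 e1 finG autG).
apply: sub_finite_set => I [x -> unst]; split=> //.
- exact: right_ideal_left_fixed.
- by apply: has_right_dim_tilted; lia.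
Qed.
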